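(* For the case $p\gg n$, the overall computational cost (number of floating point operations) of the MLADMM algorithm described in the context, run for $K$ iterations, is $$\begin{cases}O(p^2)+O(np)\times K, & \text{if } \boldsymbol X\in\mathbb R^{n\times p}\text{ (a general numerical matrix)},\\ O(p)+O(p)\times K, & \text{if } \boldsymbol X=\boldsymbol I_p,\end{cases}$$ where $K$ is the total number of iterations and $\boldsymbol I_p$ is the $p$-dimensional identity matrix.
   Context: Data and notation: $\boldsymbol X\in\mathbb R^{n\times p}$, $\boldsymbol\gamma\in\mathbb R^n$, $\bar{\boldsymbol y}\in\mathbb R^n$, $\tau\in[0,1]$, $\lambda_1,\lambda_2\ge0$, $\mu_1,\mu_2>0$. $\boldsymbol F$ is the $(p-1)\times p$ matrix with $1$ on the diagonal, $-1$ on the superdiagonal and $0$ elsewhere. When $\boldsymbol X=\boldsymbol I_p$ one has $n=p$. The algorithm solves $\min\frac1n\sum_i\rho_\tau(r_i)+\lambda_1\|\boldsymbol\beta\|_1+\lambda_2\|\boldsymbol b\|_1$ subject to $\boldsymbol X\boldsymbol\beta+\boldsymbol\gamma\beta_0+\boldsymbol r=\bar{\boldsymbol y}$, $\boldsymbol F\boldsymbol\beta=\boldsymbol b$, where $\rho_\tau(t)=t(\tau-\mathbf 1\{t<0\})$. Write $\tilde{\boldsymbol\beta}=(\beta_0,\boldsymbol\beta^\top)^\top$, $$\tilde{\boldsymbol X}=\begin{bmatrix}\sqrt{\mu_1}\,[\boldsymbol\gamma,\boldsymbol X]\\ \sqrt{\mu_2}\,[\boldsymbol 0_{p-1},\boldsymbol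 F]\end{bmatrix},\qquad \tilde{\boldsymbol y}^k=\begin{bmatrix}\sqrt{\mu_1}(\bar{\boldsymbol y}-\boldsymbol r^k+\boldsymbol u^k/\mu_1)\\ \sqrt{\mu_2}(\boldsymbol b^k+\boldsymbol v^k/\mu_2)\end{bmatrix}.$$ Preprocessing: the largest eigenvalue $\rho(\tilde{\boldsymbol X}^\top\tilde{\boldsymbol X})$ is estimated by the power method applied to $\tilde{\boldsymbol X}^\top\tilde{\boldsymbol X}$ (with loose tolerance; its number of iterations is regarded as bounded by a constant), and $\eta>\rho(\tilde{\boldsymbol X}^\top\tilde{\boldsymbol X})$ is chosen. Each of the $K$ iterations: set $\boldsymbol g^k=\tilde{\boldsymbol X}^\top(\tilde{\boldsymbol X}\tilde{\boldsymbol\beta}^k-\tilde{\boldsymbol y}^k)$ and compute in order: 1. $\beta_0^{k+1}=\beta_0^k-(\boldsymbol g^k)_1/\eta$. 2. $\beta_i^{k+1}=\operatorname{sign}(s_i)\max\{0,|s_i|-\lambda_1/\eta\}$, $s_i=\beta_i^k-(\boldsymbol g^k)_{i+1}/\eta$, $1\le i\le p$. 3. $b_i^{k+1}=\operatorname{sign}(t_i)\max\{0,|t_i|-\lambda_2/\mu_2\}$, $t_i=(\boldsymbol F\boldsymbol\beta^{k+1})_i-v_i^k/\mu_2$, $1\le i\le p-1$. 4. $r_i^{k+1}=\max\{q_i-\tfrac{\tau}{n\mu_1},\min(0,q_i+\tfrac{1-\tau}{n\mu_1})\}$, $q_i=\bar y_i-(\boldsymbol X\boldsymbol\beta^{k+1})_i-\beta_0^{k+1}\gamma_i+u_i^k/\mu_1$,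 $1\le i\le n$. 5. $\boldsymbol u^{k+1}=\boldsymbol u^k-\mu_1(\boldsymbol X\boldsymbol\beta^{k+1}+\boldsymbol\gamma\beta_0^{k+1}+\boldsymbol r^{k+1}-\bar{\boldsymbol y})$, $\boldsymbol v^{k+1}=\boldsymbol v^k-\mu_2(\boldsymbol F\boldsymbol\beta^{k+1}-\boldsymbol b^{k+1})$. The overall cost counts the preprocessing and all $K$ iterations; the structure (bidiagonality of $\boldsymbol F$, and diagonality of $\boldsymbol X$ when $\boldsymbol X=\boldsymbol I_p$) is exploited in matrix-vector products. *)

(* Defs.v *)
(* Floating point operations are modelled by exact real operations. *)
From HB Require Import structures.
From mathcomp Require Import all_boot all_order all_algebra.
From mathcomp Require Import reals.
From mathcomp Require Import ring.

Set Implicit Arguments.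
Unset Strict Implicit.
Unset Printing Implicit Defensive.

Import Order.TTheory GRing.Theory Num.Theory.
Local Open Scope ring_scope.

(* A computation: its result and the number of floating point operations
   performed.  Only the primitives fadd, ..., fleq below cost anything; reading,
   storing and copying entries is free. *)
Record counted (A : Type) := Counted { value : A; flops : nat }.

Definition ret (A : Type) (a : A) : counted A := Counted a 0.

Definition bind (A B : Type) (m : counted A) (f : A -> counted B) : counted B :=
  Counted (value (f (value m))) (flops m + flops (f (value m))).

Notation "'let*' x ':=' m 'in' k" := (bind m (fun x => k))
  (at level 200, x name, m at level 100, k at level 200,
   format "'[v' 'let*'  x  ':='  m  'in' '/' k ']'").

Section Primitives.
Variable R : rcfType.

Definition fadd (x y : R) := Counted (x + y) 1.
Definition fsub (x y : R) := Counted (x - y) 1.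
Definition fmul (x y : R) := Counted (x * y) 1.
Definition fdiv (x y : R) := Counted (x / y) 1.
Definition fsqrt (x : R) := Counted (Num.sqrt x) 1.
Definition fabs (x : R) := Counted `|x| 1.
Definition fsg (x : R) := Counted (Num.sg x) 1.
Definition fmax (x y : R) := Counted (Num.max x y) 1.
Definition fmin (x y : R) := Counted (Num.min x y) 1.
Definition fleq (x y : R) := Counted (x <= y) 1.

Definition col_for n (f : 'I_n -> counted R) : counted 'cV[R]_n :=
  Counted (\col_i value (f i)) (\sum_i flops (f i))%N.

Definition sum_for n (f : 'I_n -> counted R) : counted R :=
  foldr (fun i acc => let* s := acc in let* t := f i in fadd t s)
        (ret 0) (enum 'I_n).

Lemma value_sum_for n (f : 'I_n -> counted R) :
  value (sum_for f) = \sum_i value (f i).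
Proof.
rewrite /sum_for -big_enum /=.
by elim: (enum 'I_n) => [|i s IH]; rewrite ?big_nil // big_cons /= IH.
Qed.

Definition fdot n (x y : 'cV[R]_n) : counted R :=
  sum_for (fun i => fmul (x i 0) (y i 0)).

Definition dense_mul m n (A : 'M[R]_(m, n)) (x : 'cV[R]_n) :
    counted 'cV[R]_m :=
  col_for (fun i => sum_for (fun j => fmul (A i j) (x j 0))).

Lemma value_dense_mul m n (A : 'M[R]_(m, n)) x :
  value (dense_mul A x) = A *m x.
Proof. by apply/colP=> i; rewrite !mxE value_sum_for. Qed.

(* The storage format of the design matrix X decides how products with X and
   X^T are computed. *)
Inductive design : nat -> nat -> Type :=
| Dense n p of 'M[R]_(n, p) : design n p
| Diagonal p of 'rV[R]_p : design p p.
Arguments Dense {n p} _.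
Arguments Diagonal {p} _.

Definition design_mx n p (D : design n p) : 'M[R]_(n, p) :=
  match D in design n p return 'M[R]_(n, p) with
  | @Dense n p X => X
  | @Diagonal p d => diag_mx d
  end.

Definition mulX n p (D : design n p) : 'cV[R]_p -> counted 'cV[R]_n :=
  match D in design n p return 'cV[R]_p -> counted 'cV[R]_n with
  | @Dense n p X => dense_mul X
  | @Diagonal p d => fun x => col_for (fun i => fmul (d 0 i) (x i 0))
  end.

Definition mulXtr n p (D : design n p) : 'cV[R]_n -> counted 'cV[R]_p :=
  match D in design n p return 'cV[R]_n -> counted 'cV[R]_p with
  | @Dense n p X => dense_mul X^T
  | @Diagonal p d => fun x => col_for (fun i => fmul (d 0 i) (x i 0))
  end.

Lemma value_mulX n p (D : design n p) x : value (mulX D x) = design_mx D *m x.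
Proof.
case: D x => [m q A | q d] x /=; first exact: value_dense_mul.
by rewrite mul_diag_mx; apply/colP=> i; rewrite !mxE.
Qed.

Lemma value_mulXtr n p (D : design n p) x :
  value (mulXtr D x) = (design_mx D)^T *m x.
Proof.
case: D x => [m q A | q d] x; first exact: value_dense_mul.
by rewrite /= tr_diag_mx mul_diag_mx; apply/colP=> i; rewrite !mxE.
Qed.

Definition Fmx p : 'M[R]_(p.-1, p) :=
  \matrix_(i, j) ((j == i :> nat)%:R - (j == i.+1 :> nat)%:R).

(* The k-th entry (from 0) of a vector, and 0 out of range. *)
Definition entry n (x : 'cV[R]_n) (k : nat) : R :=
  if insub k is Some i then x i 0 else 0.

Definition mulF p (x : 'cV[R]_p) : counted 'cV[R]_p.-1 :=
  col_for (fun i : 'I_p.-1 => fsub (entry x i) (entry x i.+1)).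

Definition mulFtr p (w : 'cV[R]_p.-1) : counted 'cV[R]_p :=
  col_for (fun j : 'I_p =>
    fsub (entry w j) (if nat_of_ord j is k.+1 then entry w k else 0)).

Lemma entryE n (x : 'cV[R]_n) k :
  entry x k = \sum_(i < n) (i == k :> nat)%:R * x i 0.
Proof.
rewrite /entry; case: insubP => [i _ ik | kn].
  rewrite (bigD1 i) //= ik eqxx mul1r big1 ?addr0 // => j ji.
  by rewrite -ik (inj_eq val_inj) (negbTE ji) mul0r.
rewrite big1 // => i _; case: eqP => [ik|]; last by rewrite mul0r.
by rewrite -ik ltn_ord in kn.
Qed.

Lemma value_mulF p (x : 'cV[R]_p) : value (mulF x) = Fmx p *m x.
Proof.
apply/colP=> i; rewrite !mxE /= !entryE -sumrB; apply: eq_bigr => j _.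
by rewrite mxE mulrBl.
Qed.

Lemma value_mulFtr p (w : 'cV[R]_p.-1) : value (mulFtr w) = (Fmx p)^T *m w.
Proof.
apply/colP=> j; rewrite !mxE /=.
under eq_bigr => i _ do rewrite !mxE mulrBl.
rewrite sumrB entryE; congr (_ - _).
  by apply: eq_bigr => i _; rewrite eq_sym.
case: (nat_of_ord j) => [|k]; first by rewrite big1 // => i _; rewrite mul0r.
by rewrite entryE; apply: eq_bigr => i _; rewrite eqSS eq_sym.
Qed.

End Primitives.

Record data (R : rcfType) (n p : nat) := Data {
  gam : 'cV[R]_n;
  ybar : 'cV[R]_n;
  tau : R;
  lam1 : R;
  lam2 : R;
  mu1 : R;
  mu2 : R }.

Definition admissible (R : rcfType) n p (P : data R n p) : Prop :=
  [/\ 0 <= tau P <= 1, 0 <= lam1 P, 0 <= lam2 P, 0 < mu1 P & 0 < mu2 P].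

Record state (R : rcfType) (n p : nat) := State {
  beta0 : R;
  beta : 'cV[R]_p;
  bvar : 'cV[R]_p.-1;
  rvar : 'cV[R]_n;
  uvar : 'cV[R]_n;
  vvar : 'cV[R]_p.-1 }.

Section Mathematical.
Variables (R : rcfType) (n p : nat).
Implicit Types (X : 'M[R]_(n, p)) (P : data R n p) (s : state R n p).

Definition Xtilde X P : 'M[R]_(n + p.-1, 1 + p) :=
  block_mx (Num.sqrt (mu1 P) *: gam P) (Num.sqrt (mu1 P) *: X)
           0 (Num.sqrt (mu2 P) *: Fmx R p).

Definition betatilde s : 'cV[R]_(1 + p) := col_mx (beta0 s)%:M (beta s).

Definition ytilde P s : 'cV[R]_(n + p.-1) :=
  col_mx (Num.sqrt (mu1 P) *: (ybar P - rvar s + (mu1 P)^-1 *: uvar s))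
         (Num.sqrt (mu2 P) *: (bvar s + (mu2 P)^-1 *: vvar s)).

Definition largest_eigenvalue m (A : 'M[R]_m) (rho : R) : Prop :=
  eigenvalue A rho /\ forall a, eigenvalue A a -> a <= rho.

Definition soft_threshold (x c : R) : R := Num.sg x * Num.max 0 (`|x| - c).

Definition admm_step X P (eta : R) s : state R n p :=
  let g := (Xtilde X P)^T *m (Xtilde X P *m betatilde s - ytilde P s) in
  let beta0' := beta0 s - usubmx g 0 0 / eta in
  let beta' := \col_i soft_threshold (beta s i 0 - dsubmx g i 0 / eta)
                                     (lam1 P / eta) in
  let b' := \col_i soft_threshold
                     ((Fmx R p *m beta') i 0 - vvar s i 0 / mu2 P)
                     (lam2 P / mu2 P) in
  let q := ybar P - X *m beta' - beta0' *: gam P + (mu1 P)^-1 *: uvar s in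
  let r' := \col_i Num.max
              (q i 0 - tau P / (n%:R * mu1 P))
              (Num.min 0 (q i 0 + (1 - tau P) / (n%:R * mu1 P))) in
  let u' := uvar s - mu1 P *: (X *m beta' + beta0' *: gam P + r' - ybar P) in
  let v' := vvar s - mu2 P *: (Fmx R p *m beta' - b') in
  State beta0' beta' b' r' u' v'.

End Mathematical.

Section Algorithm.
Variables (R : rcfType) (n p : nat) (D : design R n p) (P : data R n p).
Implicit Types (s : state R n p) (w : 'cV[R]_n * 'cV[R]_p.-1)
  (z : R * 'cV[R]_p).

(* Products with Xtilde and its transpose, which is never formed: [s1] and [s2]
   are the precomputed square roots of mu1 and mu2, and a vector with 1 + p
   (resp. n + (p - 1)) entries is kept as the pair of its two blocks. *)
Definition mulXt (s1 s2 : R) z : counted ('cV[R]_n * 'cV[R]_p.-1) :=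
  let* Xz := mulX D z.2 in
  let* w1 := col_for (fun i =>
    let* t := fmul (gam P i 0) z.1 in
    let* t' := fadd t (Xz i 0) in
    fmul s1 t') in
  let* Fz := mulF z.2 in
  let* w2 := col_for (fun i => fmul s2 (Fz i 0)) in
  ret (w1, w2).

Definition mulXttr (s1 s2 : R) w : counted (R * 'cV[R]_p) :=
  let* d := fdot (gam P) w.1 in
  let* z0 := fmul s1 d in
  let* Xw := mulXtr D w.1 in
  let* Fw := mulFtr w.2 in
  let* z1 := col_for (fun j =>
    let* t := fmul s1 (Xw j 0) in
    let* t' := fmul s2 (Fw j 0) in
    fadd t t') in
  ret (z0, z1).

Definition col_of_pair z : 'cV[R]_(1 + p) := col_mx z.1%:M z.2.

Let s1 := Num.sqrt (mu1 P).
Let s2 := Num.sqrt (mu2 P).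
Let Xt := Xtilde (design_mx D) P.

Lemma value_mulXt z :
  col_mx (value (mulXt s1 s2 z)).1 (value (mulXt s1 s2 z)).2
  = Xt *m col_of_pair z.
Proof.
rewrite /Xt /Xtilde mul_block_col -/s1 -/s2 mul0mx add0r.
rewrite -[LHS]/(col_mx
  (\col_i (s1 * (gam P i 0 * z.1 + value (mulX D z.2) i 0)))
  (\col_i (s2 * value (mulF z.2) i 0))).
rewrite value_mulX value_mulF; congr col_mx; apply/colP=> i; last first.
  by rewrite -scalemxAl [LHS]mxE [RHS]mxE.
by rewrite mul_mx_scalar -scalemxAl !mxE; ring.
Qed.

Lemma value_mulXttr w :
  col_of_pair (value (mulXttr s1 s2 w)) = Xt^T *m col_mx w.1 w.2.
Proof.
rewrite /Xt /Xtilde tr_block_mx mul_block_col -/s1 -/s2 trmx0 mul0mx addr0.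
rewrite -[LHS]/(col_mx (s1 * value (fdot (gam P) w.1))%:M
  (\col_j (s1 * value (mulXtr D w.1) j 0 + s2 * value (mulFtr w.2) j 0))).
congr col_mx; last first.
  rewrite value_mulXtr value_mulFtr !linearZ /= -!scalemxAl.
  by apply/colP=> j; rewrite !mxE.
rewrite linearZ /= -scalemxAl; apply/colP=> i.
rewrite ord1 !mxE eqxx mulr1n value_sum_for; congr (_ * _).
by apply: eq_bigr => j _; rewrite mxE.
Qed.

Definition fdot_pair z z' : counted R :=
  let* t := fdot z.2 z'.2 in
  let* t0 := fmul z.1 z'.1 in
  fadd t0 t.

(* Power method on Xtilde^T * Xtilde with relative tolerance [tol], started from
   [z], [lam] being the current Rayleigh quotient.  At most [maxit] iterations
   are performed. *)
Fixpoint power_method (tol r1 r2 : R) (maxit : nat) (z : R * 'cV[R]_p) (lam : R)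
    : counted R :=
  if maxit is m.+1 then
    let* nz2 := fdot_pair z z in
    let* nz := fsqrt nz2 in
    let* x0 := fdiv z.1 nz in
    let* x1 := col_for (fun j => fdiv (z.2 j 0) nz) in
    let* w := mulXt r1 r2 (x0, x1) in
    let* z' := mulXttr r1 r2 w in
    let* lam' := fdot_pair (x0, x1) z' in
    let* dl := fsub lam' lam in
    let* err := fabs dl in
    let* al := fabs lam' in
    let* thr := fmul tol al in
    let* stop := fleq err thr in
    if stop then ret lam' else power_method tol r1 r2 m z' lam'
  else ret lam.

(* eta is the power method estimate plus a margin [delta]; since [delta] is
   arbitrary, every value of eta can be chosen. *)
Definition preprocessing (tol : R) (maxit : nat) (z : R * 'cV[R]_p) (delta : R)
    : counted (R * R * R) :=
  let* r1 := fsqrt (mu1 P) in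
  let* r2 := fsqrt (mu2 P) in
  let* lam := power_method tol r1 r2 maxit z 0 in
  let* eta := fadd lam delta in
  ret (r1, r2, eta).

Definition fsoft (x c : R) : counted R :=
  let* a := fabs x in
  let* d := fsub a c in
  let* m := fmax 0 d in
  let* e := fsg x in
  fmul e m.

Definition gradient (r1 r2 : R) s : counted (R * 'cV[R]_p) :=
  let* Xb := mulXt r1 r2 (beta0 s, beta s) in
  let* d1 := col_for (fun i =>
    let* a := fsub (ybar P i 0) (rvar s i 0) in
    let* c := fdiv (uvar s i 0) (mu1 P) in
    let* e := fadd a c in
    let* y := fmul r1 e in
    fsub (Xb.1 i 0) y) in
  let* d2 := col_for (fun i =>
    let* c := fdiv (vvar s i 0) (mu2 P) in
    let* e := fadd (bvar s i 0) c in
    let* y := fmul r2 e in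
    fsub (Xb.2 i 0) y) in
  mulXttr r1 r2 (d1, d2).

Definition iteration (r1 r2 eta : R) s : counted (state R n p) :=
  let* g := gradient r1 r2 s in
  let* g0 := fdiv g.1 eta in
  let* beta0' := fsub (beta0 s) g0 in
  let* beta' := col_for (fun i =>
    let* a := fdiv (g.2 i 0) eta in
    let* x := fsub (beta s i 0) a in
    let* c := fdiv (lam1 P) eta in
    fsoft x c) in
  let* Fb := mulF beta' in
  let* b' := col_for (fun i =>
    let* a := fdiv (vvar s i 0) (mu2 P) in
    let* x := fsub (Fb i 0) a in
    let* c := fdiv (lam2 P) (mu2 P) in
    fsoft x c) in
  let* Xb := mulX D beta' in
  let* r' := col_for (fun i =>
    let* a := fsub (ybar P i 0) (Xb i 0) in
    let* c := fmul beta0' (gam P i 0) in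
    let* d := fsub a c in
    let* e := fdiv (uvar s i 0) (mu1 P) in
    let* q := fadd d e in
    let* nm := fmul n%:R (mu1 P) in
    let* t := fdiv (tau P) nm in
    let* lo := fsub q t in
    let* ct := fsub 1 (tau P) in
    let* t' := fdiv ct nm in
    let* hi := fadd q t' in
    let* mn := fmin 0 hi in
    fmax lo mn) in
  let* u' := col_for (fun i =>
    let* c := fmul beta0' (gam P i 0) in
    let* a := fadd (Xb i 0) c in
    let* d := fadd a (r' i 0) in
    let* e := fsub d (ybar P i 0) in
    let* f := fmul (mu1 P) e in
    fsub (uvar s i 0) f) in
  let* v' := col_for (fun i =>
    let* a := fsub (Fb i 0) (b' i 0) in
    let* f := fmul (mu2 P) a in
    fsub (vvar s i 0) f) in
  ret (State beta0' beta' b' r' u' v').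

Fixpoint iterations (r1 r2 eta : R) (K : nat) s : counted (state R n p) :=
  if K is k.+1 then
    let* s' := iteration r1 r2 eta s in iterations r1 r2 eta k s'
  else ret s.

Definition mladmm (tol : R) (maxit : nat) (z : R * 'cV[R]_p) (delta : R)
    (K : nat) s : counted (state R n p) :=
  let* c := preprocessing tol maxit z delta in
  iterations c.1.1 c.1.2 c.2 K s.

Definition chosen_eta (tol : R) (maxit : nat) (z : R * 'cV[R]_p) (delta : R) : R :=
  (value (preprocessing tol maxit z delta)).2.

Lemma value_gradient s :
  col_of_pair (value (gradient s1 s2 s))
  = Xt^T *m (Xt *m betatilde s - ytilde P s).
Proof.
rewrite -[value _]/(value (mulXttr s1 s2
  (\col_i ((value (mulXt s1 s2 (beta0 s, beta s))).1 i 0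
           - s1 * (ybar P i 0 - rvar s i 0 + uvar s i 0 / mu1 P)),
   \col_i ((value (mulXt s1 s2 (beta0 s, beta s))).2 i 0
           - s2 * (bvar s i 0 + vvar s i 0 / mu2 P))))).
rewrite value_mulXttr; congr (_ *m _).
have -> : betatilde s = col_of_pair (beta0 s, beta s) by [].
rewrite -value_mulXt /ytilde opp_col_mx add_col_mx -/s1 -/s2.
set w := value _.
by congr col_mx; apply/colP=> i; rewrite !mxE; ring.
Qed.

Lemma value_iteration eta s :
  value (iteration s1 s2 eta s) = admm_step (design_mx D) P eta s.
Proof.
have soft x c : value (fsoft x c) = soft_threshold x c by [].
rewrite /admm_step -/Xt -value_gradient.
set z := value (gradient _ _ _).
have -> : usubmx (col_of_pair z) 0 0 = z.1 by rewrite col_mxKu mxE eqxx.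
have -> : dsubmx (col_of_pair z) = z.2 by rewrite col_mxKd.
rewrite -value_mulF -value_mulX.
set be := \col_i soft_threshold _ (lam1 P / eta).
set be0 := beta0 s - _.
set bv := \col_i soft_threshold _ (lam2 P / mu2 P).
set q := ybar P - _ - _ + _.
set rv := \col_i Num.max _ _.
have qE : q = \col_i (ybar P i 0 - value (mulX D be) i 0 - be0 * gam P i 0
                      + uvar s i 0 / mu1 P).
  by apply/colP=> i; rewrite /q; move: (value _) => w; rewrite !mxE; ring.
have rvE : rv = \col_i Num.max (q i 0 - tau P / (n%:R * mu1 P))
    (Num.min 0 (q i 0 + (1 - tau P) / (n%:R * mu1 P))) by [].
have uE : uvar s - mu1 P *: (value (mulX D be) + be0 *: gam P + rv - ybar P)
    = \col_i (uvar s i 0 - mu1 P * (value (mulX D be) i 0 + be0 * gam P i 0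
                                    + rv i 0 - ybar P i 0)).
  by move: (value _) => w; apply/colP=> i; rewrite 6!mxE [RHS]mxE !mxE; ring.
have vE : vvar s - mu2 P *: (value (mulF be) - bv)
    = \col_i (vvar s i 0 - mu2 P * (value (mulF be) i 0 - bv i 0)).
  by move: (value _) => w; apply/colP=> i; rewrite 3!mxE [RHS]mxE !mxE; ring.
have rvE' : rv = \col_i Num.max
    (ybar P i 0 - value (mulX D be) i 0 - be0 * gam P i 0
       + uvar s i 0 / mu1 P - tau P / (n%:R * mu1 P))
    (Num.min 0 (ybar P i 0 - value (mulX D be) i 0 - be0 * gam P i 0
       + uvar s i 0 / mu1 P + (1 - tau P) / (n%:R * mu1 P))).
  by apply/colP=> i; rewrite rvE qE [LHS]mxE [RHS]mxE [X in X - _]mxE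
                             [X in Num.min _ (X + _)]mxE.
by rewrite uE vE rvE'.
Qed.

Lemma value_mladmm tol maxit z delta K s :
  value (mladmm tol maxit z delta K s)
  = iter K (admm_step (design_mx D) P (chosen_eta tol maxit z delta)) s.
Proof.
rewrite -[LHS]/(value (iterations s1 s2 (chosen_eta tol maxit z delta) K s)).
move: (chosen_eta _ _ _ _) => eta.
elim: K s => [|K IH] s //; rewrite iterSr -IH.
by rewrite -value_iteration.
Qed.

End Algorithm.

(* Main.v *)
(* Everything an iteration does outside the products with X and X^T costs O(n + p),
   because F and F^T act in O(p) and the remaining updates are entrywise.  So if
   p <= m and each product with X or X^T costs at most m, one iteration and one
   power method step both cost O(m).  A dense design has m = 2np, at most 2p^2 when
   n <= p; a diagonal one has m = p. *)
Require Import Defs.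
From mathcomp Require Import all_boot all_order all_algebra.
From mathcomp Require Import reals.
From mathcomp Require Import zify.
Import Order.TTheory GRing.Theory Num.Theory.
Local Open Scope ring_scope.

(** The bound on [f] is uniform in its argument, so costs add up without any knowledge of the
    computed values. *)
Lemma flops_bind_le (A B : Type) (m : counted A) (f : A -> counted B) (a b : nat) :
  (flops m <= a)%N -> (forall x, flops (f x) <= b)%N ->
  (flops (bind m f) <= a + b)%N.
Proof. by move=> ma fb; apply: leq_add. Qed.

Lemma flops_Counted_le (A : Type) (x : A) (k : nat) : (flops (Counted x k) <= k)%N.
Proof. exact: leqnn. Qed.

Section Costs.
Variable R : rcfType.

Lemma flops_col_for_le n (f : 'I_n -> counted R) (c : nat) :
  (forall i, flops (f i) <= c)%N -> (flops (col_for f) <= n * c)%N.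
Proof.
move=> fc; rewrite -[n in (n * c)%N]card_ord -sum_nat_const.
exact: leq_sum.
Qed.

(** The extra unit per term pays for the [fadd] that accumulates it. *)
Lemma flops_sum_for_le n (f : 'I_n -> counted R) (c : nat) :
  (forall i, flops (f i) <= c)%N -> (flops (sum_for f) <= n * c.+1)%N.
Proof.
move=> fc; rewrite /sum_for -[n in (n * _)%N](size_enum_ord n).
elim: (enum 'I_n) => //= i l IH.
by rewrite mulSn addn1 addnC; apply: leq_add IH; rewrite ltnS.
Qed.

End Costs.

(** Applied to a goal whose upper bound is still an existential variable: the bound is read off the
    structure of the code, and hypotheses in context supply the costs of subroutines. Arithmetic
    then compares it with the stated bound. *)
Ltac bound_flops :=
  repeat first
    [ eapply flops_bind_le; [|intro]
    | eapply flops_col_for_le; intro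
    | eapply flops_sum_for_le; intro
    | apply flops_Counted_le
    | match goal with bound : forall _, _ |- _ => eapply bound end ].

Section Bounds.
Variables (R : rcfType) (n p : nat) (D : design R n p) (P : data R n p) (m : nat).
Hypothesis n_le_p : (n <= p)%N.
Hypothesis p_gt0 : (0 < p)%N.
Hypothesis p_le_m : (p <= m)%N.
Hypothesis mulX_le : forall x, (flops (mulX D x) <= m)%N.
Hypothesis mulXtr_le : forall x, (flops (mulXtr D x) <= m)%N.

Lemma flops_mulXt_le s1 s2 z : (flops (mulXt D P s1 s2 z) <= 6 * m)%N.
Proof. by eapply leq_trans; [rewrite /mulXt /mulF; bound_flops | lia]. Qed.

(** The count is at most 2n + 1 + m + p + 3p; the lone scalar product is absorbed because 1 <= p <=
    m. *)
Lemma flops_mulXttr_le s1 s2 w : (flops (mulXttr D P s1 s2 w) <= 8 * m)%N.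
Proof. by eapply leq_trans; [rewrite /mulXttr /fdot /mulFtr; bound_flops | lia]. Qed.

Lemma flops_fdot_pair_le (z z' : R * 'cV[R]_p) : (flops (fdot_pair z z') <= 4 * m)%N.
Proof. by eapply leq_trans; [rewrite /fdot_pair /fdot; bound_flops | lia]. Qed.

Lemma flops_power_method_le tol r1 r2 maxit z lam :
  (flops (power_method D P tol r1 r2 maxit z lam) <= 30 * maxit * m)%N.
Proof.
have mulXtB := flops_mulXt_le.
have mulXttrB := flops_mulXttr_le.
have dotB := flops_fdot_pair_le.
elim: maxit z lam => [|k IH] z lam //.
(* Stopping early is free, so the recursive bound covers both branches. The step itself costs at
   most 22m for its products, p for normalizing and 7 scalar operations, hence 30m. *)
have if_le (b : bool) x y :
    (flops (if b then ret x else power_method D P tol r1 r2 k y x) <= 30 * k * m)%N.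
  by case: b.
by eapply leq_trans; [rewrite [power_method _ _ _ _ _ _ _ _]/=; bound_flops | nia].
Qed.

Lemma flops_preprocessing_le tol maxit z delta :
  (flops (preprocessing D P tol maxit z delta) <= (30 * maxit + 3) * m)%N.
Proof.
have powB := flops_power_method_le.
by eapply leq_trans; [rewrite /preprocessing; bound_flops | nia].
Qed.

(** At most 23m goes to the gradient and 42m to the updates, so 80 leaves slack. *)
Lemma flops_iteration_le r1 r2 eta s : (flops (iteration D P r1 r2 eta s) <= 80 * m)%N.
Proof.
have mulXtB := flops_mulXt_le.
have mulXttrB := flops_mulXttr_le.
by eapply leq_trans; [rewrite /iteration /gradient /fsoft /mulF; bound_flops | lia].
Qed.

Lemma flops_iterations_le r1 r2 eta K s :
  (flops (iterations D P r1 r2 eta K s) <= 80 * m * K)%N.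
Proof.
elim: K s => [|K IH] s //.
by rewrite mulnS; apply: flops_bind_le => //; apply: flops_iteration_le.
Qed.

Lemma flops_mladmm_le tol maxit z delta K s :
  (flops (mladmm D P tol maxit z delta K s)
     <= (30 * maxit + 3) * m + 80 * m * K)%N.
Proof.
apply: flops_bind_le; first exact: flops_preprocessing_le.
by move=> c; apply: flops_iterations_le.
Qed.

End Bounds.

Lemma flops_dense_mul_le (R : rcfType) n p (A : 'M[R]_(n, p)) x :
  (flops (dense_mul A x) <= n * (p * 2))%N.
Proof. by rewrite /dense_mul; bound_flops. Qed.

Theorem proposition2 (R : realType) (maxit : nat) :
  (exists C1 C2 : nat,
     forall (n p : nat) (X : 'M[R]_(n, p)) (P : data R n p)
            (tol : R) (z : R * 'cV[R]_p) (delta rho : R)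
            (s : state R n p) (K : nat),
       (0 < n)%N -> (n <= p)%N -> admissible P ->
       largest_eigenvalue ((Xtilde X P)^T *m Xtilde X P) rho ->
       rho < chosen_eta (Dense X) P tol maxit z delta ->
       (flops (mladmm (Dense X) P tol maxit z delta K s)
          <= C1 * p ^ 2 + C2 * (n * p) * K)%N)
  /\
  (exists C1 C2 : nat,
     forall (p : nat) (d : 'rV[R]_p) (P : data R p p)
            (tol : R) (z : R * 'cV[R]_p) (delta rho : R)
            (s : state R p p) (K : nat),
       (0 < p)%N -> diag_mx d = 1%:M -> admissible P ->
       largest_eigenvalue ((Xtilde 1%:M P)^T *m Xtilde 1%:M P) rho ->
       rho < chosen_eta (Diagonal d) P tol maxit z delta ->
       (flops (mladmm (Diagonal d) P tol maxit z delta K s)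
          <= C1 * p + C2 * p * K)%N).
Proof.
split.
  (* These are the constants of [flops_mladmm_le] doubled, since m = 2np. *)
  exists (2 * (30 * maxit + 3))%N, 160%N.
  move=> n p X P tol z delta rho s K n0 np _ _ _.
  apply: leq_trans.
    apply: (flops_mladmm_le _ _ _ (Dense X) P (2 * (n * p))) => //.
    - by lia.
    - by nia.
    - by move=> x; apply: leq_trans (flops_dense_mul_le _ _ _ X x) _; lia.
    - by move=> x; apply: leq_trans (flops_dense_mul_le _ _ _ X^T x) _; lia.
  (* Only the preprocessing term is relaxed to p^2; the iteration term keeps np. *)
  have npp : (n * p <= p ^ 2)%N by rewrite expnS expn1 leq_mul2r np orbT.
  by nia.
exists (30 * maxit + 3)%N, 80%N => p d P tol z delta rho s K p0 _ _ _ _.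
(* Here m = p: a diagonal product takes one multiplication per entry. *)
by apply: flops_mladmm_le => // x; rewrite -[leqRHS]muln1; apply: flops_col_for_le.
Qed.
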